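(* Let $E$ be an order continuous Köthe function space, let $X$ be a real Banach space, and let $Y$ be a separable closed linear subspace of $X$. If $Y$ is a central subspace of $X$, then $E(Y)$ is a central subspace of $E(X)$.
   Context: All Banach spaces are real; ''subspace'' means closed linear subspace; $B_X(x,r)$ denotes the closed ball in $X$ with center $x$ and radius $r>0$. Köthe function space: let $(\Omega,\Sigma,\mu)$ be a $\sigma$-finite measure space. A Köthe function space $E$ (on it) is a Banach space of (classes of a.e. equal) real-valued measurable functions such that (1) $\chi_A\in E$ for every $A\in\Sigma$ of finite measure; (2) if $g\in E$ and $f$ is a measurable function with $|f(\omega)|\le|g(\omega)|$ for almost all $\omega\in\Omega$, then $f\in E$ and $\|f\|_E\le\|g\|_E$. $E$ is order continuous if for every decreasing sequence $(f_n)$ in $E$ converging to $0$ pointwise for almost all $\omega\in\Omega$ one has $\lim_n\|f_n\|=0$. Köthe–Bochner function space: $E(X)$ is the collection of all (strongly) measurable functions $F:\Omega\to X$ (modulo a.e. equality) such that $[\omega\mapsto\|F(\omega)\|_X]\in E$, with norm $\|F\|_{E(X)}=\big\|\,\|F(\cdot)\|_X\,\big\|_E$. Central subspace: a subspace $Y$ of a Banach space $X$ is a central subspace of $X$ if every finite family of closed balls with centers in $Y$ that has nonempty intersection in $X$ also intersects in $Y$; i.e. for all $y_1,\dots,y_n\in Y$ and $r_1,\dots,r_n>0$, $\bigcap_{i=1}^n B_X(y_i,r_i)\neq\emptyset$ implies $Y\cap\bigcap_{i=1}^n B_X(y_i,r_i)\neq\emptyset$. *)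

(* Defs.v *)
From HB Require Import structures.
From mathcomp Require Import all_boot all_order all_algebra.
From mathcomp Require Import all_classical all_reals all_analysis.
From mathcomp Require Import measurable_realfun generic_quotient ring_quotient.
Set Implicit Arguments.
Unset Strict Implicit.
Unset Printing Implicit Defensive.
Import Order.TTheory GRing.Theory Num.Theory numFieldNormedType.Exports.
Local Open Scope classical_set_scope.
Local Open Scope ring_scope.

Section subspaces.
Context (R : realType) (V : normedModType R).

Definition closed_subspace (Y : set V) :=
  submod_closed (mem Y) /\ closed Y.

Definition separable_set (Y : set V) :=
  exists D : set V, [/\ countable D, D `<=` Y & Y `<=` closure D].

Definition central_subspace (Y : set V) :=
  closed_subspace Y /\
  forall (n : nat) (y : 'I_n -> V) (r : 'I_n -> R),
    (forall i, Y (y i)) -> (forall i, 0 < r i) ->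
    \bigcap_(i : 'I_n) closed_ball (y i) (r i) !=set0 ->
    (Y `&` \bigcap_(i : 'I_n) closed_ball (y i) (r i)) !=set0.

End subspaces.

(* A Koethe function space is a Banach space of classes of a.e. equal           *)
(* measurable functions.  It is given here by the set of all representatives of *)
(* its classes together with the norm as a function of a representative (the    *)
(* values of [kothe_norm] outside [kothe_fun] are irrelevant).  Since           *)
(* [kothe_ideal] only compares |f| and |g| almost everywhere, membership and    *)
(* norm depend only on the class of a measurable function.                      *)
Record kothe_space d (T : measurableType d) (R : realType)
    (mu : {sigma_finite_measure set T -> \bar R}) := KotheSpace {
  kothe_fun : set (T -> R) ;
  kothe_norm : (T -> R) -> R ;
  kothe_measurable : forall f, kothe_fun f -> measurable_fun [set: T] f ;
  kothe_linear : forall (a : R) f g, kothe_fun f -> kothe_fun g ->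
    kothe_fun (fun w => a * f w + g w) ;
  kothe_normD : forall f g, kothe_fun f -> kothe_fun g ->
    kothe_norm (f \+ g) <= kothe_norm f + kothe_norm g ;
  kothe_normZ : forall (a : R) f, kothe_fun f ->
    kothe_norm (fun w => a * f w) = `|a| * kothe_norm f ;
  kothe_norm_eq0 : forall f, kothe_fun f -> kothe_norm f = 0 ->
    {ae mu, forall w, f w = 0} ;
  kothe_complete : forall f : nat -> T -> R, (forall n, kothe_fun (f n)) ->
    (forall e : R, 0 < e -> exists N, forall m n, (N <= m)%N -> (N <= n)%N ->
      kothe_norm (f m \- f n) < e) ->
    exists2 g, kothe_fun g & kothe_norm (f n \- g) @[n --> \oo] --> (0 : R) ;
  kothe_indic : forall A, measurable A -> (mu A < +oo)%E -> kothe_fun \1_A ;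
  kothe_ideal : forall f g : T -> R, kothe_fun g -> measurable_fun [set: T] f ->
    {ae mu, forall w, `|f w| <= `|g w|} ->
    kothe_fun f /\ kothe_norm f <= kothe_norm g
}.

Definition order_continuous d (T : measurableType d) (R : realType)
    (mu : {sigma_finite_measure set T -> \bar R}) (E : kothe_space mu) :=
  forall f : nat -> T -> R, (forall n, kothe_fun E (f n)) ->
    (forall n, {ae mu, forall w, f n.+1 w <= f n w}) ->
    {ae mu, forall w, f n w @[n --> \oo] --> (0 : R)} ->
    kothe_norm E (f n) @[n --> \oo] --> (0 : R).

Section strong_measurability.
Context d (T : measurableType d) (R : realType) (X : normedModType R).

Definition simple_fun (s : T -> X) :=
  finite_set (range s) /\ forall x, measurable (s @^-1` [set x]).

(* F is strongly measurable as a map from T to Y, a subset of X: both F and the *)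
(* simple functions converging to it are Y-valued.  Pointwise convergence is    *)
(* required everywhere: every a.e. limit of simple functions is a.e. equal to   *)
(* such a function, so the classes are the usual ones, and w |-> `|F w| is      *)
(* then measurable even if the measure is not complete.                         *)
Definition strongly_measurable (Y : set X) (F : T -> X) :=
  (forall w, Y (F w)) /\
  exists s : nat -> T -> X, [/\ forall n, simple_fun (s n),
    forall n w, Y (s n w) & forall w, s n w @[n --> \oo] --> F w].

Lemma simple_fun_comp (Z : Type) (Z' : Type) (f : T -> Z) (h : Z -> Z') :
  finite_set (range f) -> (forall x, measurable (f @^-1` [set x])) ->
  finite_set (range (h \o f)) /\
  (forall B, measurable ((h \o f) @^-1` B)).
Proof.
move=> fin mf; split.
  apply: sub_finite_set (finite_image h fin) => _ [w _ <-].
  by exists (f w) => //; exists w.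
move=> B.
have -> : (h \o f) @^-1` B =
    \bigcup_(x in range f `&` (h @^-1` B)) (f @^-1` [set x]).
  apply/seteqP; split=> [w /= Bw|w [x [_ /= Bx] /= fw]];
    last by rewrite fw.
  by exists (f w) => //; split=> //; exists w.
by apply: fin_bigcup_measurable => [|x _]; [exact: finite_setIl|exact: mf].
Qed.

Lemma strongly_measurable_linear (a : R) F G :
  strongly_measurable setT F -> strongly_measurable setT G ->
  strongly_measurable setT (a *: F + G).
Proof.
move=> [_ [s [ss _ cs]]] [_ [t [st _ ct]]]; split=> //.
exists (fun n => a *: s n + t n); split=> // [n|w]; last first.
  by apply: cvgD (ct w); apply: cvgZr (cs w).
have [fs ms] := ss n; have [ft mt] := st n.
pose p w := (s n w, t n w).
have fp : finite_set (range p).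
  apply: (@sub_finite_set _ _ (range (s n) `*` range (t n))).
    by move=> _ [w _ <-]; split; exists w.
  exact: finite_setX.
have mp x : measurable (p @^-1` [set x]).
  have -> : p @^-1` [set x] =
      s n @^-1` [set x.1] `&` t n @^-1` [set x.2].
    by apply/seteqP; case: x => x y; split=> w; rewrite /p /= => -[-> ->].
  exact: measurableI.
have [h1 h2] := simple_fun_comp (fun q => a *: q.1 + q.2) fp mp.
by split=> // x; exact: h2.
Qed.

Lemma strongly_measurable_norm F : strongly_measurable setT F ->
  measurable_fun [set: T] (fun w => `|F w|).
Proof.
move=> [_ [s [ss _ cs]]].
apply: (@measurable_fun_cvg _ _ _ _ (fun n w => `|s n w|)).
  move=> n _ B mB; rewrite setTI.
  have [fs ms] := ss n.
  exact: (simple_fun_comp (fun x : X => `|x|) fs ms).2.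
by move=> w _; apply: cvg_norm; exact: cs.
Qed.

End strong_measurability.

Section kothe_bochner.
Context d (T : measurableType d) (R : realType).
Context (mu : {sigma_finite_measure set T -> \bar R}).
Variables (E : kothe_space mu) (X : normedModType R).

Definition kb_fun : {pred T -> X} :=
  mem [set F | strongly_measurable setT F /\ kothe_fun E (fun w => `|F w|)].

Lemma kb_fun_submod_closed : submod_closed kb_fun.
Proof.
have E0 : kothe_fun E 0.
  rewrite (_ : 0 = \1_set0); last by rewrite indic0.
  by apply: kothe_indic; rewrite ?measure0.
split.
  rewrite inE; split; last first.
    by rewrite (_ : (fun _ => _) = 0) //; apply/funext => w /=; rewrite normr0.
  split=> //; exists (fun _ => 0); split=> // [_|w]; last exact: cvg_cst.
  split.
    by apply: (@sub_finite_set _ _ [set 0]) => // _ [w _ <-].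
  move=> x; rewrite (_ : 0 = cst 0) // preimage_cst.
  by case: ifP => _; [exact: measurableT|exact: measurable0].
move=> a F G; rewrite !inE => -[mF EF] [mG EG].
have mFG := strongly_measurable_linear a mF mG.
split=> //.
have EFG := kothe_linear `|a| EF EG.
apply: (kothe_ideal EFG (strongly_measurable_norm mFG) _).1.
apply: aeW => w; rewrite normr_id.
by apply: le_trans (ler_norm _); rewrite (le_trans (ler_normD _ _))// normrZ.
Qed.

HB.instance Definition _ :=
  GRing.isSubmodClosed.Build _ _ kb_fun kb_fun_submod_closed.

Record kbFun := KBFun { kb_val :> T -> X ; _ : kb_val \in kb_fun }.
HB.instance Definition _ := [isSub for kb_val].
HB.instance Definition _ := [Choice of kbFun by <:].
HB.instance Definition _ := [SubChoice_isSubLmodule of kbFun by <:].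

Definition kb_null : {pred kbFun} :=
  mem [set F : kbFun | {ae mu, forall w, F w = 0}].

Lemma kb_null_zmod_closed : zmod_closed kb_null.
Proof.
split; first by rewrite inE; exact: aeW.
move=> F G; rewrite !inE => F0 G0; apply: filterS2 F0 G0 => w /= F0 G0.
by rewrite -[LHS]/(kb_val F w - kb_val G w) F0 G0 subrr.
Qed.

HB.instance Definition _ :=
  GRing.isZmodClosed.Build _ kb_null kb_null_zmod_closed.

Local Open Scope quotient_scope.

Definition kothe_bochner : Type := Quotient.quot kb_null.
HB.instance Definition _ := GRing.Zmodule.on kothe_bochner.
HB.instance Definition _ := EqQuotient.on kothe_bochner.

Definition kb_class (F : kbFun) : kothe_bochner := \pi_kothe_bochner F.

Lemma kb_classP (F G : kbFun) :
  kb_class F = kb_class G <-> {ae mu, forall w, F w = G w}.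
Proof.
have -> : (kb_class F = kb_class G) <-> (F - G \in kb_null).
  by rewrite Quotient.idealrBE; split=> [FG|/eqP]; [exact/eqP|].
rewrite inE; split; apply: filterS => w /=.
  by rewrite -[LHS in LHS = _]/(kb_val F w - kb_val G w) => /subr0_eq.
by move=> FG; rewrite -[LHS]/(kb_val F w - kb_val G w) FG subrr.
Qed.

Lemma kb_class_repr (c : kothe_bochner) : kb_class (repr c) = c.
Proof. exact: reprK. Qed.

Lemma kb_classD F G : kb_class (F + G) = kb_class F + kb_class G.
Proof. exact: Quotient.pi_add. Qed.

Definition kb_scale (a : R) (c : kothe_bochner) : kothe_bochner :=
  kb_class (a *: repr c).

Lemma kb_classZ a F : kb_scale a (kb_class F) = kb_class (a *: F).
Proof.
apply/kb_classP.
have /kb_classP := kb_class_repr (kb_class F).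
by apply: filterS => w Fw; rewrite -[LHS]/(a *: kb_val (repr (kb_class F)) w) Fw.
Qed.

Lemma kb_scaleA a b c : kb_scale a (kb_scale b c) = kb_scale (a * b) c.
Proof. by rewrite -[c]kb_class_repr !kb_classZ scalerA. Qed.

Lemma kb_scale1 : left_id 1 kb_scale.
Proof. by move=> c; rewrite -[c]kb_class_repr kb_classZ scale1r. Qed.

Lemma kb_scaleDr : right_distributive kb_scale +%R.
Proof.
move=> a b c; rewrite -[b]kb_class_repr -[c]kb_class_repr .
by rewrite -kb_classD !kb_classZ -kb_classD scalerDr.
Qed.

Lemma kb_scaleDl c : {morph kb_scale^~ c : a b / a + b}.
Proof.
by move=> a b; rewrite -[c]kb_class_repr  !kb_classZ -kb_classD scalerDl.
Qed.

HB.instance Definition _ := GRing.Zmodule_isLmodule.Build R kothe_bochner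
  kb_scaleA kb_scale1 kb_scaleDr kb_scaleDl.

Definition kb_norm (c : kothe_bochner) : R :=
  kothe_norm E (fun w => `|repr c w|).

Lemma kb_funP (F : kbFun) :
  strongly_measurable setT F /\ kothe_fun E (fun w => `|F w|).
Proof. by have := valP F; rewrite inE. Qed.

Lemma kb_norm_class F : kb_norm (kb_class F) = kothe_norm E (fun w => `|F w|).
Proof.
have /kb_classP FE := kb_class_repr (kb_class F).
have [mF EF] := kb_funP F; have [mG EG] := kb_funP (repr (kb_class F)).
apply/eqP; rewrite eq_le; apply/andP; split.
  apply: (kothe_ideal EF (strongly_measurable_norm mG) _).2.
  by apply: filterS FE => w ->.
apply: (kothe_ideal EG (strongly_measurable_norm mF) _).2.
by apply: filterS FE => w ->.
Qed.

Lemma kb_normD b c : kb_norm (b + c) <= kb_norm b + kb_norm c.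
Proof.
rewrite -[b]kb_class_repr -[c]kb_class_repr -kb_classD !kb_norm_class.
set F := repr b; set G := repr c.
have [mF EF] := kb_funP F; have [mG EG] := kb_funP G.
have [mFG _] := kb_funP (F + G).
apply: le_trans (kothe_normD EF EG).
have EFG : kothe_fun E ((fun w => `|F w|) \+ (fun w => `|G w|)).
  have := kothe_linear 1 EF EG.
  by congr kothe_fun; apply/funext => w; rewrite /= mul1r.
apply: (kothe_ideal EFG (strongly_measurable_norm mFG) _).2.
apply: aeW => w; rewrite normr_id ger0_norm ?addr_ge0//.
exact: ler_normD.
Qed.

Lemma kb_normZ a c : kb_norm (a *: c) = `|a| * kb_norm c.
Proof.
rewrite -[c]kb_class_repr  -[_ *: _]/(kb_scale _ _) kb_classZ.
rewrite !kb_norm_class -[`|a|]normr_id -(kothe_normZ _ (kb_funP _).2); congr kothe_norm.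
by apply/funext => w; exact: normrZ.
Qed.

Lemma kb_norm0_eq0 c : kb_norm c = 0 -> c = 0.
Proof.
rewrite -[c]kb_class_repr  kb_norm_class => F0.
have -> : 0 = kb_class 0.
  by apply: (addrI (kb_class 0)); rewrite addr0 -kb_classD addr0.
apply/kb_classP; apply: filterS (kothe_norm_eq0 (kb_funP _).2 F0) => w /eqP.
by rewrite normr_eq0 => /eqP.
Qed.

HB.instance Definition _ :=
  Lmodule_isNormed.Build R kothe_bochner kb_normD kb_normZ kb_norm0_eq0.

(* E(Y), as a subset of E(X): the classes that contain a strongly measurable    *)
(* Y-valued function.                                                           *)
Definition kothe_bochner_sub (Y : set X) : set kothe_bochner :=
  [set c | exists2 F : kbFun, strongly_measurable Y F & c = kb_class F].

End kothe_bochner.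

Arguments kothe_bochner_sub {d T R mu} E {X} Y.

(* Main.v *)
(* For [F i] in E(Y) and [G] in E(X), centrality of [Y] gives for each [w] a
   point of [Y] whose distance to every [F i w] is at most that of [G w]; it
   remains to choose it measurably in [w].  This is a measurable selection
   problem for a closed-valued map into the separable complete [Y] whose values
   are the sets where a Caratheodory function is nonpositive.  The set of [w]
   for which this value meets a given finite intersection of balls is a
   projection, which may fail to be measurable, so it is replaced by a
   measurable hull.  Off a null set one can then refine the balls step by step,
   always taking the first admissible ball of the next radius, and the centres
   converge to the selection.  The norm bounds in E(X) follow from the
   pointwise ones. *)
Require Import Defs.
From mathcomp Require Import all_boot all_order all_algebra.
From mathcomp Require Import all_classical all_reals all_analysis.
From mathcomp Require Import measurable_realfun.
Import Order.TTheory GRing.Theory Num.Theory.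
Import numFieldNormedType.Exports.
Local Open Scope classical_set_scope.
Local Open Scope ring_scope.

Set Implicit Arguments.
Unset Strict Implicit.
Unset Printing Implicit Defensive.

(** * Measurable hulls of arbitrary sets *)

Section measurable_hull.
Context d (T : measurableType d) (R : realType).
Implicit Types (mu : {measure set T -> \bar R}) (A B C : set T).

(** Intersecting a minimising sequence of measurable supersets of [A] attains the infimum of their
    measures. For a competitor [C], the set [B] cut with [C] still covers [A], so it cannot have
    smaller measure than [B]. *)
Lemma measurable_hull_fin mu A D : A `<=` D -> measurable D ->
  (mu D < +oo)%E ->
  exists B, [/\ measurable B, A `<=` B &
    forall C, measurable C -> A `<=` C -> mu (B `\` C) = 0%E].
Proof.
move=> AD mD Doo.
(* Competitors stay inside [D], so their measures are finite and the infimum can be taken in the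
   reals. *)
pose S := [set x | exists B, [/\ measurable B, A `<=` B, B `<=` D &
  x = fine (mu B)]].
have muE B : measurable B -> B `<=` D -> mu B = (fine (mu B))%:E.
  move=> mB BD; rewrite fineK// ge0_fin_numE//.
  by apply: le_lt_trans Doo; apply: le_measure; rewrite ?inE.
have S0 : S !=set0 by exists (fine (mu D)); exists D; split.
have Slb : has_inf S.
  by split=> //; exists 0 => _ [B [_ _ _ ->]]; exact: fine_ge0.
have /choice[F PF] n : exists B, [/\ measurable B, A `<=` B, B `<=` D &
    fine (mu B) < inf S + n.+1%:R^-1].
  have n0 : 0 < n.+1%:R^-1 :> R by rewrite invr_gt0.
  have [_ [B [mB AB BD ->]] lt] := inf_adherent n0 Slb.
  by exists B.
have mF : measurable (\bigcap_n F n).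
  by apply: bigcap_measurable => [|n _]; [exists 0%N|have [] := PF n].
have AF : A `<=` \bigcap_n F n.
  by move=> w Aw n _; have [_ AF _ _] := PF n; exact: AF.
have FD : \bigcap_n F n `<=` D.
  by move=> w /(_ 0%N I); have [_ _ FD _] := PF 0%N; exact: FD.
exists (\bigcap_n F n); split=> // C mC AC.
set B := \bigcap_n F n in mF AF FD *.
have mBC := measurableI _ _ mF mC.
have BCD : B `&` C `<=` D by move=> w [/FD].
have Ble : fine (mu B) <= inf S.
  apply/ler_addgt0Pr => e e0.
  have [n ne] : exists n, n.+1%:R^-1 < e.
    have [n _ /(_ n (leqnn n))] := near_infty_natSinv_lt (PosNum e0).
    by exists n.
  have [mFn _ FnD lt] := PF n.
  apply: (@le_trans _ _ (fine (mu (F n)))); last first.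
    by rewrite ltW// (lt_trans lt)// ltrD2l.
  rewrite -lee_fin -!muE//; apply: le_measure; rewrite ?inE//.
  exact: bigcap_inf.
have BCge : inf S <= fine (mu (B `&` C)).
  apply: ge_inf; first by case: Slb.
  by exists (B `&` C); split=> // w Aw; split; [exact: AF|exact: AC].
have -> : mu (B `\` C) = (fine (mu B) - fine (mu (B `&` C)))%:E.
  rewrite EFinB -(muE _ mF FD) -(muE _ mBC BCD) measureD//.
  by apply: le_lt_trans Doo; apply: le_measure; rewrite ?inE.
apply/eqP; rewrite eqe subr_eq0 eq_le (le_trans Ble BCge)/=.
by rewrite -lee_fin -!muE//; apply: le_measure; rewrite ?inE//; exact: subIsetl.
Qed.

(** The hulls of the traces of [A] on countably many pieces of finite measure are glued; the defects
    are null piece by piece. *)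
Lemma measurable_hull (mu : {sigma_finite_measure set T -> \bar R}) A :
  exists B, [/\ measurable B, A `<=` B &
    forall C, measurable C -> A `<=` C -> mu (B `\` C) = 0%E].
Proof.
have [F UF PF] := sigma_finiteT mu.
have /choice[G PG] i : exists B, [/\ measurable B, A `&` F i `<=` B &
    forall C, measurable C -> A `&` F i `<=` C -> mu (B `\` C) = 0%E].
  have [mFi Foo] := PF i.
  exact: measurable_hull_fin (@subIsetr _ _ _) mFi Foo.
have mG : measurable (\bigcup_i G i).
  by apply: bigcup_measurable => i _; have [] := PG i.
exists (\bigcup_i G i); split=> //.
  move=> w Aw; have : [set: T] w by [].
  by rewrite UF => -[i _ Fw]; exists i => //; have [_ AG _] := PG i; exact: AG.
move=> C mC AC; apply/negligibleP; first exact: measurableD.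
rewrite setD_bigcupl; apply: negligible_bigcup => i.
have [mGi _ /(_ C mC) G0] := PG i.
apply/negligibleP; first exact: measurableD.
by apply: G0 => w [/AC].
Qed.

End measurable_hull.

(** * Measurable choice of a branch in a countably branching tree *)

Section measurable_branch.
Context d (T : measurableType d).

(* 0 when no index satisfies [P] *)
Definition first_index (P : nat -> Prop) : nat :=
  if pselect (exists j, `[< P j >]) is left e then ex_minn e else 0%N.

Lemma first_indexP (P : nat -> Prop) : (exists j, P j) -> P (first_index P).
Proof.
move=> [j Pj]; rewrite /first_index; case: pselect => [e|]; last first.
  by case; exists j; exact/asboolP.
by case: ex_minnP => m /asboolP.
Qed.

Lemma first_index_default (P : nat -> Prop) :
  (forall j, ~ P j) -> first_index P = 0%N.
Proof.
move=> nP; rewrite /first_index; case: pselect => // e.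
by exfalso; case: e => j /asboolP; exact: nP.
Qed.

Lemma measurable_first_index (P : nat -> set T) :
  (forall j, measurable (P j)) ->
  forall j, measurable [set w | first_index (fun i => P i w) = j].
Proof.
move=> mP j.
(* The default value puts the points where every [P i] fails into the fibre over 0. *)
have -> : [set w | first_index (fun i => P i w) = j] =
    (P j `\` \bigcup_(i in [set i | (i < j)%N]) P i) `|`
    (if j == 0%N then ~` (\bigcup_i P i) else set0).
  apply/seteqP; split=> [w /= <-|w /=].
    rewrite /first_index; case: pselect => [e|ne]; last first.
      by right=> -[i _ Pi]; apply: ne; exists i; exact/asboolP.
    left; case: ex_minnP => m /asboolP Pm minm; split=> // -[i /= im Pi].
    by have := minm i (asboolT Pi); rewrite leqNgt im.
  rewrite /first_index => -[[Pj nP]|]; last first.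
    case: eqP => // -> nP; case: pselect => // e.
    by exfalso; case: e => i /asboolP Pi; apply: nP; exists i.
  case: pselect => [e|[]]; last by exists j; exact/asboolP.
  case: ex_minnP => m /asboolP Pm minm; apply/eqP.
  rewrite eqn_leq (minm _ (asboolT Pj)) andTb leqNgt; apply/negP => mj.
  by apply: nP; exists m.
apply: measurableU.
  by apply: measurableD => //; exact: bigcup_measurable.
by case: ifP => // _; apply/measurableC/bigcup_measurable.
Qed.

(** Nodes list the latest choice first, so the children of [s] are the [j :: s]. *)
Fixpoint branch (a : seq nat -> set T) (n : nat) (w : T) : seq nat :=
  if n is m.+1 then
    let s := branch a m w in first_index (fun j => a (j :: s) w) :: s
  else [::].

Lemma measurable_branch (a : seq nat -> set T) :
  (forall s, measurable (a s)) ->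
  forall n s, measurable [set w | branch a n w = s].
Proof.
move=> ma; elim=> [|n IH] s /=.
  case: s => [|j s].
    by rewrite (_ : mkset _ = setT)//; apply/seteqP; split.
  by rewrite (_ : mkset _ = set0)//; apply/seteqP; split.
case: s => [|j s]; first by rewrite (_ : mkset _ = set0)//; apply/seteqP; split.
rewrite (_ : mkset _ = [set w | branch a n w = s] `&`
    [set w | first_index (fun i => a (i :: s) w) = j]).
  by apply: measurableI; [exact: IH|exact: measurable_first_index].
by apply/seteqP; split=> w /= [+ +]; [move=> <- <-|move=> -> <-].
Qed.

(* The sets [A s] need not be measurable; minimality of their hulls preserves
   the covering condition up to a null set. *)
Lemma measurable_branch_scheme (R : realType)
    (mu : {sigma_finite_measure set T -> \bar R}) (A B : seq nat -> set T) :
  A [::] = setT -> (forall s, A s `<=` \bigcup_j A (j :: s)) ->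
  (forall s, measurable (B s)) -> (forall s, A s `<=` B s) ->
  exists a, [/\ forall s, measurable (a s),
    {ae mu, forall w, forall n, B (branch a n w) w} &
    forall w, (forall n, B (branch a n w) w) \/ (forall s, ~ a s w)].
Proof.
move=> A0 AU mB AB.
have /choice[H PH] s := measurable_hull mu (A s).
pose K s := H s `&` B s.
have mK s : measurable (K s) by apply: measurableI => //; have [] := PH s.
have AK s : A s `<=` K s.
  by move=> w Aw; split; [have [_ AH _] := PH s; exact: AH|exact: AB].
(* These are the points that reach [s] but no child of [s]. The sets [K (j :: s)] together cover
   [A s], so minimality of the hull [H s] makes [Z s] null. *)
pose Z s := K s `\` \bigcup_j K (j :: s).
have mZ s : measurable (Z s).
  by apply: measurableD => //; exact: bigcup_measurable.
have Z0 s : mu.-negligible (Z s).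
  have [mH _ /(_ (\bigcup_j K (j :: s)))] := PH s.
  have mU : measurable (\bigcup_j K (j :: s)) by exact: bigcup_measurable.
  move=> /(_ mU) HU0.
  apply: (@negligibleS _ _ _ _ (H s `\` \bigcup_j K (j :: s))).
    by move=> w [[]].
  apply/negligibleP; first exact: measurableD.
  by apply: HU0 => w /AU [j _ /AK Kj]; exists j.
pose N := \bigcup_n (if unpickle n is Some s then Z s else set0).
have mN : measurable N.
  by apply: bigcup_measurable => n _; case: (unpickle n : option (seq nat)).
have N0 : mu.-negligible N.
  apply: negligible_bigcup => n.
  case: (unpickle n : option (seq nat)) => [s|] //; exact: negligible_set0.
(* Removing [N] from every node gives a clean alternative: off [N] the branch always continues, and
   on [N] no node is admissible at all. *)
pose a s := K s `\` N.
have aP w : ~ N w -> forall n, K (branch a n w) w.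
  move=> nN; elim=> [|n IH]; first by apply: AK; rewrite /= A0.
  rewrite /=; set s := branch a n w.
  have [j aj] : exists j, a (j :: s) w.
    apply: contrapT => na; apply: (nN).
    exists (pickle s) => //; rewrite pickleK.
    split; first exact: IH.
    move=> -[j _ Kj]; apply: na; by exists j; split.
  by have [] := first_indexP (ex_intro (fun j => a (j :: s) w) j aj).
exists a; split.
- by move=> s; exact: measurableD.
- apply: negligibleS N0 => w /= nB; apply: contrapT => nN; apply: nB => n.
  by have [] := aP w nN n.
- move=> w; have [Nw|nN] := pselect (N w).
    by right=> s [].
  by left=> n; have [] := aP w nN n.
Qed.

End measurable_branch.

(** * Countably valued maps, nearest points and strong measurability *)

Lemma preimage_countable_measurable d (T : measurableType d) (U : countType)
    (V : Type) (g : T -> U) (f : U -> V) (S : set V) :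
  (forall u, measurable [set w | g w = u]) ->
  measurable ((fun w => f (g w)) @^-1` S).
Proof.
move=> mg; pose F u := if pselect (S (f u)) then [set w | g w = u] else set0.
rewrite (_ : _ @^-1` _ = \bigcup_u F u).
  apply: countable_bigcupT_measurable; first exact: countableP.
  move=> u; rewrite /F; case: pselect => [p|p]; first exact: mg.
  exact: measurable0.
apply/seteqP; split=> [w /= Sw|w [u _]].
  by exists (g w) => //; rewrite /F; case: pselect.
by rewrite /F; case: pselect => //= Su gw; rewrite gw.
Qed.

Section nearest_point.
Context (R : realType).

Fixpoint nearest (g : nat -> R) (n : nat) : nat :=
  if n is m.+1 then
    if g m.+1 < g (nearest g m) then m.+1 else nearest g m
  else 0%N.

Lemma nearest_bound g n : (nearest g n <= n)%N.
Proof. by elim: n => //= n IH; case: ifP => // _; exact: leqW. Qed.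

Lemma nearest_le g n k : (k <= n)%N -> g (nearest g n) <= g k.
Proof.
elim: n => [|n IH] /=; first by rewrite leqn0 => /eqP ->.
rewrite leq_eqVlt ltnS => /predU1P[->|/IH kn]; first by case: ltP.
by case: ltP => // lt; apply: ltW; exact: lt_le_trans lt kn.
Qed.

Lemma measurable_nearest d (T : measurableType d) (g : nat -> T -> R) :
  (forall j, measurable_fun setT (g j)) ->
  forall n i, measurable [set w | nearest (g ^~ w) n = i].
Proof.
move=> mg; elim=> [|n IH] i.
  have [->|i0] := eqVneq i 0%N.
    by rewrite (_ : mkset _ = setT)//; apply/seteqP; split.
  rewrite (_ : mkset _ = set0)//; apply/seteqP; split=> // w /= i0'.
  by rewrite -i0' in i0.
pose L k := [set w | g n.+1 w < g k w].
have mL k : measurable (L k).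
  rewrite -[L k]setTI; have := measurable_fun_ltr (mg n.+1) (mg k).
  by move=> /(_ measurableT [set true]); apply.
have -> : [set w | nearest (g ^~ w) n.+1 = i] =
    \bigcup_k ([set w | nearest (g ^~ w) n = k] `&`
      ((if n.+1 == i then L k else set0) `|`
       (if k == i then ~` L k else set0))).
  apply/seteqP; split=> [w /=|w [k _ [/= <-]]].
    move=> <-; exists (nearest (g ^~ w) n) => //; split=> //.
    case: (boolP (g n.+1 w < g (nearest (g ^~ w) n) w)) => lt; rewrite eqxx.
      by left.
    by right; exact/negP.
  by case; case: eqP => // ei Lw /=; [rewrite Lw|case: ifP].
apply: bigcup_measurable => k _; apply: measurableI; first exact: IH.
by apply: measurableU; case: ifP => // _; exact: measurableC.
Qed.

End nearest_point.

Section dense_sequence.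
Context (R : realType) (X : normedModType R).

Definition dense_seq (Y : set X) (e : nat -> X) :=
  (forall j, Y (e j)) /\
  forall y, Y y -> forall r : R, 0 < r -> exists j, `|y - e j| < r.

Lemma separable_dense_seq (Y : set X) : Y !=set0 -> separable_set Y ->
  exists e, dense_seq Y e.
Proof.
move=> [y Yy] [D [cD DY YD]].
have Dr z r : Y z -> 0 < r -> exists2 x, D x & `|z - x| < r.
  move=> Yz r0; have [x [Dx zx]] := YD z Yz _ (nbhsx_ballx z r r0).
  by exists x => //; move: zx; rewrite -ball_normE.
move: cD => /pfcard_geP[D0|[f]].
  by have [x] := Dr y 1 Yy ltr01; rewrite D0.
exists f; split=> [j|z Yz r r0]; first by apply: DY; exact: funS.
have [x Dx zx] := Dr z r Yz r0.
by have [j _ fj] := @surj _ _ _ _ f x Dx; exists j; rewrite fj.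
Qed.

(** Replacing [F w] by the nearest of [e 0], ..., [e n] gives a finitely valued map with values in
    [Y]. Its fibres are determined by comparing distances, and density gives convergence. *)
Lemma strongly_measurable_dist d (T : measurableType d) (Y : set X)
    (e : nat -> X) (F : T -> X) :
  dense_seq Y e -> (forall w, Y (F w)) ->
  (forall j, measurable_fun [set: T] (fun w => `|F w - e j|)) ->
  strongly_measurable Y F.
Proof.
move=> [Ye de] YF mF; split=> //.
pose i n w := nearest (fun j => `|F w - e j|) n.
have mi n j : measurable [set w | i n w = j].
  exact: (@measurable_nearest _ _ _ (fun j w => `|F w - e j|)).
exists (fun n w => e (i n w)); split=> // [n|w].
  split=> [|x]; last exact: preimage_countable_measurable (mi n).
  apply: (@sub_finite_set _ _ (e @` `I_n.+1)); last exact: finite_image.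
  by move=> _ [w _ <-]; exists (i n w) => //=; rewrite ltnS nearest_bound.
apply/cvgrPdist_lt => r r0.
have [k kr] := de _ (YF w) r r0.
exists k => // n /= kn; apply: le_lt_trans kr.
exact: (@nearest_le _ (fun j => `|F w - e j|)).
Qed.

End dense_sequence.

(** * Measurable selection for sublevel sets of Caratheodory functions *)

Lemma cvg_interlaced (R : realType) (X : completeNormedModType R)
    (h x : nat -> X) :
  (forall k n, (k <= n)%N -> `|x n - h k| < k.+1%:R^-1) ->
  exists2 l : X, h n @[n --> \oo] --> l & x n @[n --> \oo] --> l.
Proof.
move=> xh.
have /cauchy_cvg ch : cauchy (h @ \oo).
  apply: cauchy_exP => r r0.
  have r20 : 0 < r / 2 by rewrite divr_gt0.
  have [k _ /(_ k (leqnn k)) /= kr] := near_infty_natSinv_lt (PosNum r20).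
  exists (h k); exists k => // n /= kn; rewrite -ball_normE /=.
  (* The centres [h k] and [h n] need not lie in each other's balls; they are compared through
     [x n], which lies in both balls. *)
  have xk := xh k n kn; have xn := xh n n (leqnn n).
  have nk : n.+1%:R^-1 <= k.+1%:R^-1 :> R by rewrite lef_pV2 ?posrE// ler_nat.
  apply: le_lt_trans (ler_distD (x n) _ _) _; rewrite distrC.
  rewrite [ltRHS](splitr r) ltrD//; first exact: lt_trans xk kr.
  exact: lt_trans (lt_le_trans xn nk) kr.
exists (lim (h @ \oo)) => //.
rewrite -[X in _ --> X]add0r; rewrite (_ : x = (fun n => (x n - h n) + h n)).
  apply: cvgD => //; apply/cvgr0Pnorm_lt => r r0.
  have [k _ kr] := near_infty_natSinv_lt (PosNum r0).
  by exists k => // n /= /kr; apply: lt_trans; exact: xh.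
by apply/funext => n; rewrite subrK.
Qed.

Section caratheodory_selection.
Context d (T : measurableType d) (R : realType).
Context (mu : {sigma_finite_measure set T -> \bar R}).
Context (X : completeNormedModType R).
Implicit Types (Y : set X) (e : nat -> X) (phi : T -> X -> R).

(** The entry chosen at depth [k], counted from 1, is the centre index of an open ball of radius
    [1/(k+1)]; prepending an entry shrinks the cell. *)
Fixpoint cell e (s : seq nat) : set X :=
  if s is j :: s' then [set x | `|x - e j| < (size s).+1%:R^-1] `&` cell e s'
  else setT.

Lemma near_cell e s x : cell e s x -> \forall z \near x, cell e s z.
Proof.
elim: s => [_|j s IH [/= xj xs]]; first exact: nearT.
apply: filterI (IH xs).
have cj : `|z - e j| @[z --> x] --> `|x - e j|.
  by apply: cvg_norm; apply: cvgB; [exact: cvg_id|exact: cvg_cst].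
exact: cvgr_lt cj _ xj.
Qed.

(** Along a branch that stays in the sets [B], each cell contains a dense point where [phi w] is
    below a bound tending to 0. These points converge to the limit of the centres, and continuity of
    [phi w] carries the bound over. *)
Theorem caratheodory_selection Y e phi :
  closed Y -> dense_seq Y e ->
  (forall j, measurable_fun [set: T] (phi ^~ (e j))) ->
  (forall w, continuous (phi w)) ->
  (forall w, exists2 y, Y y & phi w y <= 0) ->
  exists H : T -> X, [/\ forall w, Y (H w),
    forall j, measurable_fun [set: T] (fun w => `|H w - e j|) &
    {ae mu, forall w, phi w (H w) <= 0}].
Proof.
move=> clY [Ye de] mphi cphi phi0.
(* [A s] is the exact condition, quantified over all of [Y]. [B s] relaxes it to a strict bound
   tested only on the dense sequence, which makes it measurable; it contains [A s] because cells are
   open and [phi w] is continuous. *)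
pose A s := [set w | exists y, [/\ Y y, cell e s y & phi w y <= 0]].
pose B s := [set w | exists m, cell e s (e m) /\
  phi w (e m) < (size s).+1%:R^-1].
have de_near y (P : set X) :
    Y y -> (\forall z \near y, P z) -> exists j, P (e j).
  move=> Yy /nbhs_ballP[r /= r0 rP]; have [j yj] := de y Yy r r0.
  by exists j; apply: rP; rewrite -ball_normE.
have A0 : A [::] = setT.
  by apply/seteqP; split=> // w _; have [y Yy p0] := phi0 w; exists y.
have AU s : A s `<=` \bigcup_j A (j :: s).
  move=> w [y [Yy sy p0]].
  have r0 : 0 < (size s).+2%:R^-1 :> R by rewrite invr_gt0.
  by have [j yj] := de y Yy _ r0; exists j => //; exists y.
have mB s : measurable (B s).
  rewrite (_ : B s = \bigcup_(m in [set m | cell e s (e m)])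
      [set w | phi w (e m) < (size s).+1%:R^-1]); last first.
    by apply/seteqP; split=> [w [m [? ?]]|w [m ? ?]]; exists m.
  apply: bigcup_measurable => m _; rewrite -[mkset _]setTI.
  have mc : measurable_fun [set: T] (fun=> (size s).+1%:R^-1 : R).
    exact: measurable_cst.
  have := measurable_fun_ltr (mphi m) mc.
  by move=> /(_ measurableT [set true]); apply.
have AB s : A s `<=` B s.
  move=> w [y [Yy sy p0]].
  apply: (de_near y (fun z => cell e s z /\ phi w z < (size s).+1%:R^-1)) => //.
  apply: filterI; first exact: near_cell.
  apply: (@cvgr_lt _ _ (nbhs y) _ (phi w) _ (cphi w y)).
  by apply: le_lt_trans p0 _; rewrite invr_gt0.
have [a [ma Bae Bor]] := measurable_branch_scheme mu A0 AU mB AB.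
(* The index is shifted because the branch of length 0 has no head; thus [h k] is chosen at depth
   [k+1] and carries radius [1/(k+2)]. *)
pose h n w := e (head 0%N (branch a n.+1 w)).
have size_branch n w : size (branch a n w) = n by elim: n => //= n ->.
have cell_branch k n w : (k <= n)%N ->
    cell e (branch a n.+1 w) `<=` [set x | `|x - h k w| < k.+2%:R^-1].
  elim: n => [|n IH].
    by rewrite leqn0 => /eqP -> x [].
  rewrite leq_eqVlt => /predU1P[->|/IH Hn] x [/=]; first by rewrite size_branch.
  by move=> _; exact: Hn.
have /choice[H PH] w : exists l : X, h n w @[n --> \oo] --> l /\
    ((forall n, B (branch a n w) w) -> phi w l <= 0).
  have [Bw|nB] := pselect (forall n, B (branch a n w) w); last first.
    (* On the exceptional set every choice falls back to index 0, so the centres are constant. The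
       limit then exists everywhere, and measurability of [H] does not depend on completeness of
       [mu]. *)
    have na s : ~ a s w by case: (Bor w) => // /(_ s).
    exists (e 0%N); split=> //.
    by rewrite (_ : h^~ w = cst (e 0%N)); [exact: cvg_cst|];
      apply/funext => n; rewrite /h /= first_index_default.
  have /choice[m Pm] n := Bw n.+1.
  have [k n kn|l hl xl] := @cvg_interlaced _ _ (h ^~ w) (fun n => e (m n)).
    have [/(cell_branch k n w kn) /= lt _] := Pm n; apply: lt_trans lt _.
    by rewrite ltf_pV2 ?posrE// ltr_nat.
  exists l; split=> // _.
  have c1 : phi w (e (m n)) @[n --> \oo] --> phi w l.
    by apply: continuous_cvg => //; exact: cphi.
  have c2 : (size (branch a n.+1 w)).+1%:R^-1 @[n --> \oo] --> (0 : R).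
    apply/cvgr0Pnorm_lt => r r0.
    have [k _ kr] := near_infty_natSinv_lt (PosNum r0).
    exists k => // n /= kn; rewrite size_branch ger0_norm//.
    apply: kr => /=; exact: leqW.
  apply: (ler_cvg_to c1 c2); apply: nearW => n.
  by have [_ /ltW] := Pm n.
exists H; split.
- move=> w; have [cH _] := PH w.
  apply: (closed_cvg Y clY _ _ cH).
  by apply: nearW => n; exact: Ye.
(* Each [h n] factors through the branch, which takes countably many values on measurable fibres. *)
- move=> j; apply: (@measurable_fun_cvg _ _ _ _ (fun n w => `|h n w - e j|)).
    move=> n _ S mS; rewrite setTI.
    exact: (preimage_countable_measurable (fun s => `|e (head 0%N s) - e j|)
      S (measurable_branch ma n.+1)).
  move=> w _; apply: cvg_norm; apply: cvgB; last exact: cvg_cst.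
  by have [] := PH w.
- by apply: filterS Bae => w Bw; have [_] := PH w; exact.
Qed.

End caratheodory_selection.

Section ball_intersection_selection.
Context d (T : measurableType d) (R : realType).
Context (mu : {sigma_finite_measure set T -> \bar R}).
Context (X : completeNormedModType R).

Lemma ball_intersection_selection (Y : set X) (e : nat -> X) n
    (F : 'I_n -> T -> X) (g : 'I_n -> T -> R) :
  closed Y -> dense_seq Y e ->
  (forall i j, measurable_fun [set: T] (fun w => `|F i w - e j|)) ->
  (forall i, measurable_fun [set: T] (g i)) ->
  (forall w, exists2 y, Y y & forall i, `|F i w - y| <= g i w) ->
  exists H : T -> X, [/\ forall w, Y (H w),
    forall j, measurable_fun [set: T] (fun w => `|H w - e j|) &
    {ae mu, forall w, forall i, `|F i w - H w| <= g i w}].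
Proof.
move=> clY de mF mg FY.
(* A sum of positive parts is nonpositive only if every summand vanishes, so one Caratheodory
   function encodes all [n] inequalities. *)
pose phi w y : R := \sum_(i < n) Num.max 0 (`|F i w - y| - g i w).
have phi_le0 w y : phi w y <= 0 <-> forall i, `|F i w - y| <= g i w.
  split=> [p0 i|le].
    rewrite -subr_le0; apply: le_trans p0.
    rewrite /phi (bigD1 i)//= -[leLHS]addr0 lerD//.
      by rewrite le_max lexx orbT.
    by apply: sumr_ge0 => j _; rewrite le_max lexx.
  by rewrite /phi big1// => i _; rewrite max_l// subr_le0.
have [||w|H [YH mH aeH]] := @caratheodory_selection _ _ _ mu _ Y e phi clY de.
- move=> j; apply: measurable_sum => i; apply: measurable_maxr.
    exact: measurable_cst.
  by apply: measurable_funB; [exact: mF|exact: mg].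
- move=> w y; apply: cvg_big => [x|i _]; first exact: add_continuous.
  apply: (@continuous_max _ _ (cst 0) (fun y => `|F i w - y| - g i w)).
    exact: cvg_cst.
  apply: cvgB; last exact: cvg_cst.
  by apply: cvg_norm; apply: cvgB; [exact: cvg_cst|exact: cvg_id].
- by have [y Yy Fy] := FY w; exists y => //; apply/phi_le0.
by exists H; split=> //; apply: filterS aeH => w /phi_le0.
Qed.

End ball_intersection_selection.

(** * [E(Y)] as a closed linear subspace of [E(X)] *)

Section kothe_bochner_facts.
Context d (T : measurableType d) (R : realType).
Context (mu : {sigma_finite_measure set T -> \bar R}).

Lemma strongly_measurable_subset (X : normedModType R) (Y Z : set X)
    (F : T -> X) : Y `<=` Z ->
  strongly_measurable Y F -> strongly_measurable Z F.
Proof.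
move=> YZ [YF [s [ss Ys cs]]]; split=> [w|]; first exact: YZ.
by exists s; split=> // n w; exact: YZ.
Qed.

Lemma strongly_measurable_cst (X : normedModType R) (x : X) :
  strongly_measurable setT (fun _ : T => x).
Proof.
split=> //; exists (fun _ _ => x); split=> // [_|w]; last exact: cvg_cst.
split; first by apply: (@sub_finite_set _ _ [set x]) => // _ [w _ <-].
move=> y; rewrite -[fun=> x]/(cst x) preimage_cst.
by case: ifP => _; [exact: measurableT|exact: measurable0].
Qed.

Lemma measurable_distance (X : normedModType R) (F : T -> X) (x : X) :
  strongly_measurable setT F -> measurable_fun [set: T] (fun w => `|F w - x|).
Proof.
move=> mF; have := strongly_measurable_norm
  (strongly_measurable_linear 1 mF (strongly_measurable_cst (- x))).
congr measurable_fun; apply/funext => w.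
by rewrite -[LHS]/(`|1 *: F w - x|) scale1r.
Qed.

(** The simple functions given for [F] may leave [Y], but they make the distances to the [e j]
    measurable, and nearest points among the [e j] supply approximants inside [Y]. *)
Lemma strongly_measurable_sub (X : normedModType R) (Y : set X) (e : nat -> X)
    (F : T -> X) : dense_seq Y e -> strongly_measurable setT F ->
  (forall w, Y (F w)) -> strongly_measurable Y F.
Proof.
move=> de mF YF; apply: strongly_measurable_dist de YF _ => j.
exact: measurable_distance.
Qed.

Context (E : kothe_space mu).

(** The ideal property compares [f] with the zero function, whose norm is 0 by homogeneity. *)
Lemma kothe_norm_ge0 f : kothe_fun E f -> 0 <= kothe_norm E f.
Proof.
move=> Ef; have <- : kothe_norm E (fun w => 0 * f w) = 0.
  by rewrite kothe_normZ// normr0 mul0r.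
have m0 : measurable_fun [set: T] (fun w => 0 * f w).
  rewrite (_ : (fun _ => _) = cst 0); first exact: measurable_cst.
  by apply/funext => w; rewrite mul0r.
by apply: (kothe_ideal Ef m0 _).2; apply: aeW => w; rewrite mul0r normr0.
Qed.

Context (X : normedModType R).

Lemma kbFun_dominated (F : T -> X) (g : T -> R) :
  strongly_measurable setT F -> kothe_fun E g ->
  {ae mu, forall w, `|F w| <= g w} ->
  exists G : kbFun E X, kb_val G = F.
Proof.
move=> mF Eg Fg; have FE : F \in kb_fun E (X := X).
  rewrite inE; split=> //.
  apply: (kothe_ideal Eg (strongly_measurable_norm mF) _).1.
  by apply: filterS Fg => w Fw; rewrite normr_id (le_trans Fw)// ler_norm.
by exists (KBFun FE).
Qed.

Lemma kb_classB (F G : kbFun E X) : kb_class F - kb_class G = kb_class (F - G).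
Proof.
by have := addrK (kb_class G) (kb_class (F - G)); rewrite -kb_classD subrK.
Qed.

Lemma kb_norm_classE (F : kbFun E X) :
  `|kb_class F| = kothe_norm E (fun w => `|F w|).
Proof. exact: kb_norm_class. Qed.

Lemma kb_class_le (F G : kbFun E X) :
  {ae mu, forall w, `|F w| <= `|G w|} -> `|kb_class F| <= `|kb_class G|.
Proof.
move=> FG; rewrite !kb_norm_classE.
have [mF _] := kb_funP F; have [_ EG] := kb_funP G.
apply: (kothe_ideal EG (strongly_measurable_norm mF) _).2.
by apply: filterS FG => w; rewrite !normr_id.
Qed.

Lemma kothe_bochner_sub_submod (Y : set X) (e : nat -> X) :
  submod_closed (mem Y) -> dense_seq Y e ->
  submod_closed (mem (kothe_bochner_sub E Y)).
Proof.
move=> [Y0 YD] de; split.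
  rewrite inE; exists 0.
    apply: (strongly_measurable_sub de (kb_funP _).1) => w.
    by move: Y0; rewrite inE.
  by apply: (addrI (kb_class 0)); rewrite addr0 -kb_classD addr0.
move=> a _ _ /set_mem[F YF ->] /set_mem[G YG ->].
rewrite inE; exists (a *: F + G); last by rewrite kb_classD -kb_classZ.
apply: (strongly_measurable_sub de (kb_funP _).1) => w.
have := YD a (F w) (G w); rewrite !inE.
by apply; [exact: YF.1|exact: YG.1].
Qed.

(* [h w] is the distance from [G w] to [Y]; every element of E(Y) at distance
   [r] from the class of [G] shows that the norm of [h] is at most [r]. *)
Lemma kothe_bochner_sub_closed (Y : set X) (e : nat -> X) :
  closed Y -> Y 0 -> dense_seq Y e -> closed (kothe_bochner_sub E Y).
Proof.
move=> clY Y0 de c clc; rewrite -[c]kb_class_repr; set G := repr c.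
have [mG EG] := kb_funP G.
(* Taking the infimum over the dense sequence only makes [h] measurable; the tail from index 0 is
   the whole sequence. *)
pose h w := infs (fun j => `|G w - e j|) 0%N.
have hlb w : has_lbound (range (fun j => `|G w - e j|)).
  by exists 0 => _ [j _ <-].
have hE w : h w = inf (range (fun j => `|G w - e j|)).
  by congr inf; apply/seteqP; split=> _ [j _ <-]; exists j.
have h0 w : 0 <= h w.
  rewrite hE; apply: lb_le_inf => [|_ [j _ <-]//].
  by exists `|G w - e 0%N|, 0%N.
have hj w j : h w <= `|G w - e j| by rewrite hE; apply: ge_inf => //; exists j.
have hY w y : Y y -> h w <= `|G w - y|.
  move=> Yy; apply/ler_addgt0Pr => r r0; have [j yj] := de.2 y Yy r r0.
  apply: le_trans (hj w j) _; apply: le_trans (ler_distD y _ _) _.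
  by rewrite lerD2l ltW.
have Yh w : h w = 0 -> Y (G w).
  move=> hw; apply: clY => B /nbhs_ballP[r /= r0 rB].
  have hi : has_inf (range (fun j => `|G w - e j|)).
    by split=> //; exists `|G w - e 0%N|, 0%N.
  have [_ [j _ <-]] := inf_adherent r0 hi.
  rewrite -hE hw add0r => lt; exists (e j); split; first exact: de.1.
  by apply: rB; rewrite -ball_normE.
have mh : measurable_fun [set: T] h.
  apply: measurable_fun_infs => [w _|j]; first exact: hlb.
  exact: measurable_distance.
have Eh : kothe_fun E h.
  apply: (kothe_ideal EG mh _).1; apply: aeW => w.
  by rewrite normr_id ger0_norm// -[G w]subr0; exact: hY.
have normh : kothe_norm E h = 0.
  apply/eqP; rewrite eq_le kothe_norm_ge0// andbT.
  apply/ler_addgt0Pr => r r0; rewrite add0r.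
  have [_ [[F YF ->]]] := clc _ (nbhsx_ballx c r r0).
  rewrite -ball_normE /= -[c]kb_class_repr kb_classB kb_norm_classE => /ltW.
  apply: le_trans.
  apply: (kothe_ideal (kb_funP (G - F)).2 mh _).2; apply: aeW => w.
  by rewrite normr_id ger0_norm//; apply: hY; exact: YF.1.
(* Membership in [E(Y)] asks for a representative with values in [Y] everywhere, so [G] is reset to
   0 on the null set where [h] is nonzero. *)
pose F w := if h w == 0 then G w else 0.
have YF w : Y (F w) by rewrite /F; case: eqP => // /Yh.
have FG : {ae mu, forall w, F w = G w}.
  apply: filterS (kothe_norm_eq0 Eh normh) => w.
  by rewrite /F => ->; rewrite eqxx.
have mF : strongly_measurable Y F.
  apply: strongly_measurable_dist de YF _ => j.
  rewrite (_ : (fun _ => _) = fun w =>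
    if h w == 0 then `|G w - e j| else `|0 - e j|); last first.
    by apply/funext => w; rewrite /F; case: ifP.
  apply: measurable_fun_ifT.
  - by apply: measurable_fun_eqr => //; exact: measurable_cst.
  - exact: measurable_distance.
  - exact: measurable_cst.
have [||F' F'E] := @kbFun_dominated F _ _ EG.
- exact: strongly_measurable_subset mF.
- by apply: filterS FG => w ->.
exists F'; first by rewrite F'E.
by apply/kb_classP; apply: filterS FG => w; rewrite F'E.
Qed.

End kothe_bochner_facts.

(** * Centrality, pointwise in [Y] and then in [E(Y)] *)

Lemma central_pointwise (R : realType) (X : normedModType R) (Y : set X) n
    (y : 'I_n -> X) (x : X) : central_subspace Y -> (forall i, Y (y i)) ->
  exists2 z, Y z & forall i, `|y i - z| <= `|y i - x|.
Proof.
move=> [_ cY] Yy.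
(* Centrality speaks of positive radii only, so the case where some distance is 0 is separated;
   there [x] itself lies in [Y]. *)
have [[i yx]|ne] := pselect (exists i, y i = x).
  by exists x => // *; rewrite -yx.
have r0 i : 0 < `|y i - x|.
  by rewrite normr_gt0 subr_eq0; apply/eqP => yx; apply: ne; exists i.
have [|z [Yz zB]] := cY n y _ Yy r0.
  by exists x => i _; rewrite closed_ballE//= /closed_ball_ /=.
by exists z => // i; have := zB i I; rewrite closed_ballE.
Qed.

Theorem theorem2p10 (d : measure_display) (T : measurableType d) (R : realType)
    (mu : {sigma_finite_measure set T -> \bar R}) (E : kothe_space mu)
    (X : completeNormedModType R) (Y : set X)
    (E_oc : order_continuous E)
    (Y_subspace : closed_subspace Y) (Y_separable : separable_set Y)
    (Y_central : central_subspace Y) :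
  central_subspace (kothe_bochner_sub E Y).
Proof.
have [subY clY] := Y_subspace.
have Y0 : Y 0 by case: subY => + _; rewrite inE.
have [e de] := separable_dense_seq (ex_intro _ 0 Y0) Y_separable.
have subE : submod_closed (mem (kothe_bochner_sub E Y)).
  exact: kothe_bochner_sub_submod subY de.
have clE : closed (kothe_bochner_sub E Y).
  exact: kothe_bochner_sub_closed clY Y0 de.
split=> // n c r cY r0 [z cz].
(* Some index is needed later to dominate the selection; for the empty family of balls the point 0
   serves. *)
have [i0|n0] := pselect (exists i : 'I_n, True); last first.
  exists 0; split; first by case: subE => + _; rewrite inE.
  by move=> i; case: n0; exists i.
have /choice[F PF] i : exists F : kbFun E X,
    strongly_measurable Y F /\ c i = kb_class F.
  by have [F] := cY i; exists F.
have YF i w : Y (F i w) by have [[]] := PF i.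
have zE := kb_class_repr z; set G := repr z in zE.
(* The pointwise radii are the distances to [G w], not the constants [r i]. Monotonicity of the norm
   then puts the class of [H] at least as close to each [c i] as [z] is. *)
have [i j|i|w|H [YH mH FH]] :=
  @ball_intersection_selection _ _ _ mu X Y e n (fun i => F i)
    (fun i w => `|F i w - G w|) clY de.
- by apply: measurable_distance; have [] := kb_funP (F i).
- by have [/strongly_measurable_norm] := kb_funP (F i - G).
- by apply: central_pointwise.
have smH : strongly_measurable Y H := strongly_measurable_dist de YH mH.
case: i0 => i0 _.
(* This dominates [H] almost everywhere: the norm of [H w] is at most that of [F i0 w] plus the
   distance from [F i0 w] to [H w], which the distance to [G w] bounds. *)
have EFG : kothe_fun E (fun w => 1 * `|F i0 w| + `|(F i0 - G) w|).
  exact: kothe_linear (kb_funP _).2 (kb_funP _).2.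
have [||H' H'E] := @kbFun_dominated _ _ _ _ _ _ H _ _ EFG.
- exact: strongly_measurable_subset smH.
- apply: filterS FH => w /(_ i0) FHw; rewrite mul1r.
  rewrite -(subKr (F i0 w) (H w)); apply: le_trans (ler_normB _ _) _.
  by rewrite lerD2l.
exists (kb_class H'); split; first by exists H' => //; rewrite H'E.
move=> i _; have := cz i I; rewrite !closed_ballE//= /closed_ball_ /=.
have [_ ->] := PF i; rewrite -zE !kb_classB; apply: le_trans.
apply: kb_class_le; apply: filterS FH => w /(_ i).
by rewrite -[(F i - H') w]/(F i w - kb_val H' w) H'E.
Qed.
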